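(* Let $X$ be a finite cell complex with filtrations $F_1X\subseteq\cdots\subseteq F_NX=X$ and $G_1X\subseteq\cdots\subseteq G_NX=X$, and suppose $G$ is a lag filtration of $F$: there is a constant integer $l\ge 0$ with $G_tX=F_{t-l}X$ for all $1\le t\le N$, where $F_tX:=0$ for $t\le 0$. Let $\mathcal D$ be the matrix of the total boundary operator $\partial$ with rows and columns both indexed by the cells of $X$ listed in an order $\sigma_1,\dots,\sigma_m$ with $b_F(\sigma_1)\le\cdots\le b_F(\sigma_m)$, and let $(J,M,\mathcal D,J)$ be a U-match decomposition of $\mathcal D$. Then the columns of $J$ contain a basis of every relative cycle space $Z(F_tX,G_tX)$ and of every relative boundary space $B(F_tX,G_tX)$, $1\le t\le N$. Consequently the barcode of the persistent relative homology module $H_*(F_1X,G_1X)\to\cdots\to H_*(F_NX,G_NX)$ has exactly one bar $[f_{ker}(u),f_{im}(u))$ for each column $u$ of $J$ (bars with $f_{ker}(u)=f_{im}(u)$ being empty and discarded), with $u$ as relative cycle representative.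
   Context: Fix a field $\mathbb K$. $C(X)=\bigoplus_pC_p(X)$ is the total cellular chain space over $\mathbb K$, with basis the cells $\sigma_1,\dots,\sigma_m$, and $\partial:C(X)\to C(X)$ is the total boundary operator, $\partial^2=0$. Thus $\partial(\sigma_j)=\sum_i\mathcal D_{ij}\sigma_i$. Each $F_tX,G_tX$ is a subcomplex; the same symbol also denotes the subspace of $C(X)$ spanned by its cells ($0$ for the empty complex), which $\partial$ maps into itself. $b_F(\sigma)=\min\{t:\sigma\in F_tX\}$. $Z(F_tX,G_tX)=\{c\in F_tX:\partial c\in G_tX\}$, $B(F_tX,G_tX)=\partial(F_tX)+G_tX$, $H_*(F_tX,G_tX)=Z(F_tX,G_tX)/B(F_tX,G_tX)$; maps in the module are induced by inclusion. For $c\in C(X)$, $f_{ker}(c)=\min\{t\in\{1,\dots,N\}:c\in Z(F_tX,G_tX)\}$ and $f_{im}(c)=\min\{t\in\{1,\dots,N\}:c\in B(F_tX,G_tX)\}$. A U-match decomposition of $D\in\mathbb K^{n\times m}$ is a tuple $(T,M,D,S)$ with $TM=DS$, $T\in\mathbb K^{n\times n}$ and $S\in\mathbb K^{m\times m}$ upper triangular with all diagonal entries $1$, and $M\in\mathbb K^{n\times m}$ having at most one nonzero entry in each row and in each column. (Here $T=S=J$, so $JM=\mathcal DJ$.) The $j$-th column of $J$ is regarded as the chain $\sum_iJ_{ij}\sigma_i$. ''The columns contain a basis of a subspace'' means that some subset of them is a basis of it. An interval module with bar $[b,d)$ equals $\mathbb K$ at indices $b\le t<d$ and $0$ elsewhere,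 with identity maps between nonzero copies of $\mathbb K$; the barcode is the multiset of bars in a decomposition of the module as a direct sum of interval modules. A relative cycle representative of a bar is a chain whose class generates that summand for all $b\le t<d$. *)

(* Defs.v *)
From HB Require Import structures.
From mathcomp Require Import all_boot all_order all_algebra.

Set Implicit Arguments.
Unset Strict Implicit.
Unset Printing Implicit Defensive.
Import GRing.Theory.
Local Open Scope ring_scope.
Local Open Scope quotient_scope.

(* The quotient of a vector space V by a subspace W: the additive quotient of
   ring_quotient, equipped with the induced scaling. *)
Section QuotientSpace.
Context {K : fieldType} {V : vectType K}.
Implicit Type W : {vspace V}.

Definition quotv W : Type := Quotient.quot (pred_of_vspace W).
HB.instance Definition _ W := GRing.Zmodule.on (quotv W).

Definition quot_class W (v : V) : quotv W :=
  \pi_(Quotient.quot (pred_of_vspace W)) v.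

Definition quot_repr W (q : quotv W) : V :=
  repr (q : Quotient.quot (pred_of_vspace W)).

Lemma quot_reprK W : cancel (@quot_repr W) (quot_class W).
Proof. exact: reprK. Qed.

Lemma quot_class_eq W (u v : V) :
  (quot_class W u = quot_class W v) <-> (u - v \in W).
Proof.
rewrite -[u - v \in W]/(u - v \in pred_of_vspace W) Quotient.idealrBE.
by split=> [eq_uv|/eqP//]; apply/eqP.
Qed.

Lemma quot_classD W : {morph quot_class W : u v / u + v}.
Proof. by move=> u v; rewrite /quot_class raddfD. Qed.

Lemma quot_repr_class W v : v - quot_repr (quot_class W v) \in W.
Proof. by apply/quot_class_eq; rewrite quot_reprK. Qed.

Definition scaleq W (a : K) (q : quotv W) : quotv W :=
  quot_class W (a *: quot_repr q).

Lemma scaleq_class W a v : scaleq a (quot_class W v) = quot_class W (a *: v).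
Proof.
apply/quot_class_eq; rewrite -scalerBr memvZ // -memvN opprB.
exact: quot_repr_class.
Qed.

Fact scaleqA W a b (q : quotv W) : scaleq a (scaleq b q) = scaleq (a * b) q.
Proof. by rewrite -[q]quot_reprK !scaleq_class scalerA. Qed.

Fact scale1q W : left_id 1 (@scaleq W).
Proof. by move=> q; rewrite -[q]quot_reprK scaleq_class scale1r. Qed.

Fact scaleqDr W : right_distributive (@scaleq W) +%R.
Proof.
move=> a p q; rewrite -[p]quot_reprK -[q]quot_reprK.
by rewrite -quot_classD !scaleq_class scalerDr quot_classD.
Qed.

Fact scaleqDl W (q : quotv W) : {morph (@scaleq W)^~ q : a b / a + b}.
Proof.
move=> a b; rewrite -[q]quot_reprK.
by rewrite !scaleq_class scalerDl quot_classD.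
Qed.

HB.instance Definition _ W := GRing.Zmodule_isLmodule.Build K (quotv W)
  (@scaleqA W) (@scale1q W) (@scaleqDr W) (@scaleqDl W).

Lemma quot_class_linear W : linear (quot_class W).
Proof. by move=> a u v; rewrite quot_classD -scaleq_class. Qed.

End QuotientSpace.

(* Persistence modules over the index set {1, ..., N}; whatever pm_sp and
   pm_map are outside this range is irrelevant. *)
Record pmodule (K : fieldType) (N : nat) := PModule {
  pm_sp :> nat -> lmodType K;
  pm_map : forall s t, pm_sp s -> pm_sp t;
  pm_map_linear : forall s t, (0 < s)%N -> (s <= t)%N -> (t <= N)%N ->
    linear (@pm_map s t);
  pm_map_id : forall t, (0 < t)%N -> (t <= N)%N -> @pm_map t t =1 id;
  pm_map_comp : forall r s t,
    (0 < r)%N -> (r <= s)%N -> (s <= t)%N -> (t <= N)%N ->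
    @pm_map s t \o @pm_map r s =1 @pm_map r t
}.

Section Barcodes.
Context {K : fieldType} {N : nat}.

(* The interval module of the bar [b, d): the boolean b <= t < d is read as a
   dimension, so the space at t is K (as 1 x 1 matrices) or 0, and pid_mx 1 is
   the identity 1 x 1 matrix or an empty matrix. *)
Definition interval_sp (bd : nat * nat) (t : nat) : lmodType K :=
  'rV[K]_(nat_of_bool (bd.1 <= t < bd.2)%N).

Definition interval_map bd s t (x : interval_sp bd s) : interval_sp bd t :=
  x *m pid_mx 1.

Fact interval_map_linear bd s t :
  (0 < s)%N -> (s <= t)%N -> (t <= N)%N -> linear (@interval_map bd s t).
Proof. by move=> _ _ _ a x y; rewrite /interval_map mulmxDl -scalemxAl. Qed.

Fact interval_map_id bd t :
  (0 < t)%N -> (t <= N)%N -> @interval_map bd t t =1 id.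
Proof.
move=> _ _ x; rewrite /interval_map; move: x; rewrite /interval_sp.
by case: (_ <= t < _)%N => x; [rewrite pid_mx_1 mulmx1 | rewrite !thinmx0].
Qed.

Fact interval_map_comp bd r s t :
  (0 < r)%N -> (r <= s)%N -> (s <= t)%N -> (t <= N)%N ->
  @interval_map bd s t \o @interval_map bd r s =1 @interval_map bd r t.
Proof.
move=> _ le_rs le_st _ x; rewrite /interval_map /= -mulmxA mul_pid_mx minnn.
congr (_ *m _); case: bd x => b d _ /=; apply/matrixP=> i j; rewrite !mxE.
have rI : (b <= r < d)%N by case: (b <= r < d)%N i => [|[]].
have tI : (b <= t < d)%N by case: (b <= t < d)%N j => [|[]].
case/andP: rI => /leq_trans/(_ le_rs) -> _.
by case/andP: tI => _ /(leq_ltn_trans le_st) ->.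
Qed.

Definition interval_mod bd : pmodule K N :=
  PModule (@interval_map_linear bd) (@interval_map_id bd)
          (@interval_map_comp bd).

Definition is_pmorphism (V W : pmodule K N) (f : forall t, V t -> W t) : Prop :=
  (forall t, (0 < t)%N -> (t <= N)%N -> linear (f t)) /\
  (forall s t, (0 < s)%N -> (s <= t)%N -> (t <= N)%N ->
     forall x, f t (pm_map t x) = pm_map t (f s x)).

(* V is the direct sum of the modules P i, embedded in V by the f i *)
Definition is_direct_sum (V : pmodule K N) (I : finType) (P : I -> pmodule K N)
    (f : forall i t, P i t -> V t) : Prop :=
  (forall i, is_pmorphism (f i)) /\
  (forall t, (0 < t)%N -> (t <= N)%N -> forall v : V t,
     exists x : forall i, P i t, v = \sum_i f i t (x i) /\
       forall y : forall i, P i t, v = \sum_i f i t (y i) ->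
         forall i, y i = x i).

(* The condition on the bars makes a bar determined by its interval module:
   it is a nonempty subset of {1, ..., N}. *)
Definition interval_decomposition (V : pmodule K N) (I : finType)
    (bar : I -> nat * nat) (f : forall i t, interval_mod (bar i) t -> V t) :
    Prop :=
  (forall i, (0 < (bar i).1 < (bar i).2)%N && ((bar i).2 <= N.+1)%N) /\
  is_direct_sum f.

(* The list s, up to permutation, is the multiset of bars of some interval
   decomposition of V. *)
Definition is_barcode (V : pmodule K N) (s : seq (nat * nat)) : Prop :=
  exists (I : finType) (bar : I -> nat * nat)
         (f : forall i t, interval_mod (bar i) t -> V t),
    interval_decomposition f /\ perm_eq s [seq bar i | i : I].

End Barcodes.

Arguments interval_mod K N bd : clear implicits.

Section CellComplexes.
Variable K : fieldType.

Definition chain (T : finType) := {ffun T -> K^o}.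

Definition cell_chain (T : finType) (s : T) : chain T :=
  [ffun r => (r == s)%:R].

(* A finite cell complex, given by its cells and its total cellular boundary
   operator over K. A subcomplex is then a set of cells whose span is mapped
   into itself by the boundary operator; closed unions of cells of a finite CW
   complex have this property. *)
Record cellComplex := CellComplex {
  cell :> finType;
  cell_dim : cell -> nat;
  boundary : 'End(chain cell);
  boundary_degree : forall s r : cell,
    boundary (cell_chain s) r != 0 -> cell_dim s = (cell_dim r).+1;
  boundaryK : (boundary \o boundary)%VF = 0
}.

Variable X : cellComplex.

Definition cell_span (A : {set X}) : {vspace chain X} :=
  <<[seq cell_chain s | s in A]>>%VS.

Definition subcomplex (A : {set X}) : Prop :=
  forall s, s \in A -> boundary X (cell_chain s) \in cell_span A.

(* F_1 X, ..., F_N X; the value of fil outside {1, ..., N} is irrelevant. *)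
Record filtration (N : nat) := Filtration {
  fil :> nat -> {set X};
  fil_gt0 : (0 < N)%N;
  fil_subcomplex : forall t, (0 < t)%N -> (t <= N)%N -> subcomplex (fil t);
  fil_mono : forall s t, (0 < s)%N -> (s <= t)%N -> (t <= N)%N ->
    fil s \subset fil t;
  fil_last : fil N = [set: X]
}.

Definition is_lag N (F G : filtration N) (l : nat) : Prop :=
  forall t, (0 < t)%N -> (t <= N)%N ->
    G t = if (l < t)%N then F (t - l)%N else set0.

(* Minimum of the t in {1, ..., N} satisfying P; it is N.+1 if there are none *)
Definition min_index (N : nat) (P : pred nat) : nat :=
  \big[minn/N.+1]_(1 <= t < N.+1 | P t) t.

Definition birth N (F : filtration N) (s : X) : nat :=
  min_index N (fun t => s \in F t).

Definition rel_cycles (A B : {set X}) : {vspace chain X} :=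
  (cell_span A :&: (boundary X @^-1: cell_span B))%VS.

Definition rel_boundaries (A B : {set X}) : {vspace chain X} :=
  (boundary X @: cell_span A + cell_span B)%VS.

Section RelativeHomology.
Context {N : nat} (F G : filtration N).

Definition f_ker (c : chain X) : nat :=
  min_index N (fun t => c \in rel_cycles (F t) (G t)).

Definition f_im (c : chain X) : nat :=
  min_index N (fun t => c \in rel_boundaries (F t) (G t)).

(* Z(F_t, G_t) as a vector space, and B(F_t, G_t) as a subspace of it *)
Definition Zsp (t : nat) := subvs_of (rel_cycles (F t) (G t)).

Definition Bsp (t : nat) : {vspace Zsp t} :=
  (linfun (vsval : Zsp t -> chain X) @^-1: rel_boundaries (F t) (G t))%VS.

Definition hom_sp (t : nat) : lmodType K := quotv (Bsp t).

(* The class of a relative cycle (for other chains the value is irrelevant) *)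
Definition hom_class (t : nat) (c : chain X) : hom_sp t :=
  quot_class (Bsp t) (vsproj (rel_cycles (F t) (G t)) c).

Definition hom_map (s t : nat) (h : hom_sp s) : hom_sp t :=
  hom_class t (vsval (quot_repr h)).

Lemma mem_Bsp t (z : Zsp t) :
  (z \in Bsp t) = (vsval z \in rel_boundaries (F t) (G t)).
Proof. by rewrite /Bsp -memv_preim lfunE. Qed.

Lemma cell_spanS (A B : {set X}) :
  A \subset B -> (cell_span A <= cell_span B)%VS.
Proof.
by move=> /subsetP sAB; apply: sub_span => _ /imageP[s sA ->];
  apply: image_f; apply: sAB.
Qed.

Lemma rel_cyclesS s t : (0 < s)%N -> (s <= t)%N -> (t <= N)%N ->
  (rel_cycles (F s) (G s) <= rel_cycles (F t) (G t))%VS.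
Proof.
move=> s0 st tN; have sFt := cell_spanS (fil_mono F s0 st tN).
have sGt := cell_spanS (fil_mono G s0 st tN).
apply/subvP=> c; rewrite !memv_cap -!memv_preim.
by case/andP=> /(subvP sFt) -> /(subvP sGt).
Qed.

Lemma rel_boundariesS s t : (0 < s)%N -> (s <= t)%N -> (t <= N)%N ->
  (rel_boundaries (F s) (G s) <= rel_boundaries (F t) (G t))%VS.
Proof.
by move=> s0 st tN; apply: addvS; [apply: limgS|]; apply: cell_spanS;
  apply: fil_mono.
Qed.

(* hom_map is induced by inclusion *)
Lemma hom_map_class s t c : (0 < s)%N -> (s <= t)%N -> (t <= N)%N ->
  c \in rel_cycles (F s) (G s) -> hom_map t (hom_class s c) = hom_class t c.
Proof.
move=> s0 st tN Zc; rewrite /hom_map /hom_class.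
apply/quot_class_eq; rewrite -linearB mem_Bsp.
set z := vsproj _ c; set r := quot_repr _.
have -> : vsval r - c = vsval (r - z) by rewrite linearB /= vsprojK.
have Brz : vsval (r - z) \in rel_boundaries (F s) (G s).
  by rewrite -mem_Bsp -memvN opprB quot_repr_class.
rewrite vsprojK; first exact: (subvP (rel_boundariesS s0 st tN)).
by apply: (subvP (rel_cyclesS s0 st tN)); apply: subvsP.
Qed.

Lemma hom_class_surj t (h : hom_sp t) :
  exists2 c, c \in rel_cycles (F t) (G t) & h = hom_class t c.
Proof.
exists (vsval (quot_repr h)); first exact: subvsP.
by rewrite /hom_class vsvalK quot_reprK.
Qed.

Lemma hom_class_linear t : linear (hom_class t).
Proof. by move=> a u v; rewrite /hom_class linearP quot_class_linear. Qed.

Fact hom_map_linear s t : (0 < s)%N -> (s <= t)%N -> (t <= N)%N ->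
  linear (@hom_map s t).
Proof.
move=> s0 st tN a x y.
have [c Zc ->] := hom_class_surj x; have [d Zd ->] := hom_class_surj y.
by rewrite -hom_class_linear !hom_map_class ?rpredD ?rpredZ ?hom_class_linear.
Qed.

Fact hom_map_id t : (0 < t)%N -> (t <= N)%N -> @hom_map t t =1 id.
Proof.
by move=> t0 tN x; have [c Zc ->] := hom_class_surj x; rewrite hom_map_class.
Qed.

Fact hom_map_comp r s t : (0 < r)%N -> (r <= s)%N -> (s <= t)%N -> (t <= N)%N ->
  @hom_map s t \o @hom_map r s =1 @hom_map r t.
Proof.
move=> r0 rs st tN x; have [c Zc ->] := hom_class_surj x => /=.
have s0 := leq_trans r0 rs; have sN := leq_trans st tN.
rewrite !hom_map_class ?(leq_trans rs st) //.
exact: (subvP (rel_cyclesS r0 rs sN)).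
Qed.

(* H_*(F_1, G_1) -> ... -> H_*(F_N, G_N) *)
Definition rel_homology : pmodule K N :=
  PModule hom_map_linear hom_map_id hom_map_comp.

(* c is a relative cycle representative of the i-th bar of the decomposition f:
   its class spans the image of the i-th summand at each index of the bar. *)
Definition cycle_representative (I : finType) (bar : I -> nat * nat)
    (f : forall i t, interval_mod K N (bar i) t -> rel_homology t)
    (i : I) (c : chain X) : Prop :=
  forall t, ((bar i).1 <= t < (bar i).2)%N ->
    c \in rel_cycles (F t) (G t) /\
    forall h : rel_homology t,
      (exists x, h = f i t x) <-> (exists a : K, h = a *: hom_class t c).

End RelativeHomology.

Section Matrices.
Context {m : nat} (sigma : 'I_m -> X).

Definition boundary_matrix : 'M[K]_m :=
  \matrix_(i, j) boundary X (cell_chain (sigma j)) (sigma i).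

Definition col_chain (J : 'M[K]_m) (j : 'I_m) : chain X :=
  \sum_i J i j *: cell_chain (sigma i).

Definition columns_contain_basis (J : 'M[K]_m) (U : {vspace chain X}) : Prop :=
  exists A : {set 'I_m}, basis_of U [seq col_chain J j | j in A].

End Matrices.

Definition unitriangular n (A : 'M[K]_n) : Prop :=
  (forall i, A i i = 1) /\ (forall i j : 'I_n, (j < i)%N -> A i j = 0).

Definition matching_matrix n p (M : 'M[K]_(n, p)) : Prop :=
  (forall i j j', M i j != 0 -> M i j' != 0 -> j = j') /\
  (forall i i' j, M i j != 0 -> M i' j != 0 -> i = i').

Definition U_match n p (T : 'M[K]_n) (M D : 'M[K]_(n, p)) (S : 'M[K]_p) : Prop :=
  [/\ T *m M = D *m S, unitriangular T, unitriangular S & matching_matrix M].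

End CellComplexes.

(* Main.v *)
Require Import Defs.
From mathcomp Require Import all_boot all_order all_algebra.
From mathcomp Require Import zify.

Set Implicit Arguments.
Unset Strict Implicit.
Unset Printing Implicit Defensive.
Import GRing.Theory.
Local Open Scope ring_scope.

(** Call a subspace U adapted to a basis u of the chain space if every chain of
    U only involves basis vectors that lie in U; then the u_j in U form a basis
    of U ([adapted_basis]).  The first claim is that all the spaces Z(F_t, G_t)
    and B(F_t, G_t) are adapted to the columns u_j of J.  They are obtained from
    the spans of F_t and G_t by intersection, sum, image and preimage under the
    boundary operator, so it suffices that each step preserves adaptedness.

    - The cells are ordered by birth, and G lags behind F, so the cells of F_t
      and of G_t form initial segments.  As J is unitriangular, a chain lies in
      the span of an initial segment only if the columns it involves are
      indexed by cells of that segment ([triangular_support]); hence the spans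
      are adapted ([adapted_cell_span]).
    - Intersections and sums of adapted subspaces are adapted whatever the
      basis.
    - J M = D J says that the boundary of u_j is the combination of the u_i with
      coefficients the j-th column of M.  As M is a matching matrix, the
      boundary operator sends each u_j to zero or to a multiple of a single u_i,
      and no u_i is hit twice, so no cancellation can occur in the boundary of a
      chain ([matching_row_sum]).  Images and preimages of adapted subspaces are
      thus adapted ([adapted_img], [adapted_preim]).

    Since B(F_t, G_t) is contained in Z(F_t, G_t) for a lag filtration, the
    homology H(F_t, G_t) has as basis the classes of the u_j lying in the second
    but not in the first, that is, with f_ker u_j <= t < f_im u_j.  The maps
    induced by inclusion send the class of u_j to the class of u_j, so each u_j
    carries an interval summand ([bar_map_decomposition]).

    The barcode does not depend on the decomposition: the image of V_s -> V_t
    has a basis indexed by the bars that contain both s and t ([image_indep],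
    [image_generated], [in_image]), so the number of these bars is the rank of
    that map, and inclusion-exclusion recovers the multiplicity of every bar
    from these ranks ([count_barE]). *)

(** * Linear maps and dimension *)

(** Modules carry their structure maps as plain functions together with a proof
    of linearity, so the consequences of linearity are restated in that form. *)
Section LinearFunctions.

Context {K : fieldType} {U W : lmodType K} (f : U -> W).
Hypothesis lin_f : linear f.

Lemma linear_zero : f 0 = 0.
Proof. by have := lin_f (-1) 0 0; rewrite !scaleN1r !addNr. Qed.

Lemma linear_scale a x : f (a *: x) = a *: f x.
Proof. by have := lin_f a x 0; rewrite linear_zero !addr0. Qed.

Lemma linear_lincomb (I : finType) (a : I -> K) (x : I -> U) :
  f (\sum_i a i *: x i) = \sum_i a i *: f (x i).
Proof.
elim/big_rec2: _ => [|i y z _ <-]; [exact: linear_zero | exact: lin_f].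
Qed.

End LinearFunctions.

(** The homology spaces are only known as modules over a field, without a
    dimension, so the invariance of the size of a basis is needed in the form
    of the exchange inequality.  If there were fewer generators than vectors,
    the coefficient matrix would have a nonzero vector in its kernel, which is
    a linear dependency. *)
Lemma leq_card_indep_gen (K : fieldType) (V : lmodType K) (I I' : finType)
    (A : {set I}) (B : {set I'}) (e : I -> V) (g : I' -> V) :
  (forall a : I -> K, \sum_(i in A) a i *: e i = 0 ->
     forall i, i \in A -> a i = 0) ->
  (forall i, i \in A -> exists a : I' -> K, e i = \sum_(j in B) a j *: g j) ->
  (#|A| <= #|B|)%N.
Proof.
move=> indep gen; rewrite leqNgt; apply/negP=> ltBA.
have /fin_all_exists[c cE] (k : 'I_#|A|) : exists a : I' -> K,
  e (enum_val k) = \sum_(j in B) a j *: g j by apply/gen/enum_valP.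
pose C : 'M[K]_(#|A|, #|B|) := \matrix_(k, j) c k (enum_val j).
have: kermx C != 0.
  rewrite kermx_eq0 /row_free neq_ltn (leq_ltn_trans _ ltBA) //.
  exact: rank_leq_col.
case/rowV0Pn=> v /sub_kermxP vC /rV0Pn[k0 vk0].
pose a i := v 0 (enum_rank_in (enum_valP k0) i).
suff: a (enum_val k0) = 0.
  by rewrite /a enum_valK_in => v0; rewrite v0 eqxx in vk0.
apply: indep (enum_valP k0); rewrite big_enum_val /=.
under eq_bigr => k _ do rewrite cE /a enum_valK_in big_enum_val scaler_sumr.
rewrite exchange_big big1 //= => j _.
under eq_bigr => k _ do rewrite scalerA.
rewrite -scaler_suml; have /matrixP/(_ 0 j) := vC; rewrite !mxE.
by under eq_bigr => k _ do rewrite mxE; move=> ->; rewrite scale0r.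
Qed.

(** * Uniqueness of barcodes *)

Section IntervalModules.

Context {K : fieldType}.
Local Notation Isp := (@interval_sp K).

(** Uniform access to the spaces of an interval module, whose dimension 0 or 1
    depends on a test: the entry of a vector is read as a sum over the 0 or 1
    indices, and the generator is 1 or the only vector. *)
Definition icoord (bd : nat * nat) t (x : Isp bd t) : K :=
  \sum_k (x : 'rV[K]_(nat_of_bool (bd.1 <= t < bd.2)%N)) 0 k.

Definition iunit (bd : nat * nat) t : Isp bd t :=
  (const_mx 1 : 'rV[K]_(nat_of_bool (bd.1 <= t < bd.2)%N)).

Lemma icoordE bd t (x : Isp bd t) : x = icoord x *: iunit bd t.
Proof.
rewrite /icoord /iunit; move: x; rewrite /interval_sp.
case: (_ <= t < _)%N => x; last by rewrite thinmx0 [RHS]thinmx0.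
by apply/rowP=> k; rewrite !mxE big_ord1 mulr1 ord1.
Qed.

Lemma icoord_linear bd t a (x y : Isp bd t) :
  icoord (a *: x + y) = a * icoord x + icoord y.
Proof.
rewrite /icoord mulr_sumr -big_split.
by apply: eq_bigr => k _; rewrite !mxE.
Qed.

Lemma icoordZ bd t a (x : Isp bd t) : icoord (a *: x) = a * icoord x.
Proof. by rewrite /icoord mulr_sumr; apply: eq_bigr => k _; rewrite !mxE. Qed.

Lemma icoord0 bd t : icoord (0 : Isp bd t) = 0.
Proof. by rewrite /icoord big1 // => k _; rewrite mxE. Qed.

Lemma icoord_unit bd t : (bd.1 <= t < bd.2)%N -> icoord (iunit bd t) = 1.
Proof.
rewrite /icoord /iunit => alive; rewrite (eq_bigr (fun=> 1)).
  by rewrite sumr_const card_ord alive.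
by move=> k _; rewrite mxE.
Qed.

Lemma interval_sp_eq0 bd t (x : Isp bd t) : ~~ (bd.1 <= t < bd.2)%N -> x = 0.
Proof.
move: x; rewrite /interval_sp; case: (_ <= t < _)%N => // x _.
exact: thinmx0.
Qed.

Lemma icoord_map bd s t (x : Isp bd s) :
  (bd.1 <= s < bd.2)%N -> (bd.1 <= t < bd.2)%N ->
  icoord (interval_map t x) = icoord x.
Proof.
rewrite /icoord /interval_map; move: x; rewrite /interval_sp.
case: (_ <= s < _)%N; case: (_ <= t < _)%N => // x _ _.
by rewrite pid_mx_1 mulmx1.
Qed.

Lemma interval_map_eq0 bd s t (x : Isp bd s) : (s <= t)%N ->
  ~~ ((bd.1 <= s) && (t < bd.2))%N -> interval_map t x = 0.
Proof.
move=> st dead; have [alive|?] := boolP (bd.1 <= t < bd.2)%N; last first.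
  exact: interval_sp_eq0.
rewrite [x]interval_sp_eq0 /interval_map ?mul0mx //; lia.
Qed.

End IntervalModules.

Section Decomposition.

Context {K : fieldType} {N : nat} (V : pmodule K N) (I : finType)
  (bar : I -> nat * nat) (f : forall i t, interval_mod K N (bar i) t -> V t).
Arguments f : clear implicits.
Hypothesis dec_f : is_direct_sum f.

Definition bars_over s t : {set I} :=
  [set i | ((bar i).1 <= s) && (t < (bar i).2)]%N.

Lemma summand_icoord i t (x : interval_sp (bar i) t) :
  (0 < t)%N -> (t <= N)%N -> f i t x = icoord x *: f i t (iunit (bar i) t).
Proof.
move=> t0 tN; have [/(_ i)[lin _] _] := dec_f.
by rewrite {1}[x]icoordE (linear_scale (lin t t0 tN)).
Qed.

Lemma summand_unit_map i s t : (0 < s)%N -> (s <= t)%N -> (t <= N)%N ->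
  pm_map t (f i s (iunit (bar i) s)) =
  (i \in bars_over s t)%:R *: f i t (iunit (bar i) t).
Proof.
move=> s0 st tN; have [/(_ i)[_ mor] _] := dec_f.
rewrite -mor //= [LHS]summand_icoord ?(leq_trans s0) //; congr (_ *: _).
rewrite inE; have [/andP[bs td]|dead] := boolP (_ && _); last first.
  by rewrite interval_map_eq0 // icoord0.
rewrite icoord_map ?icoord_unit // ?bs ?td ?andbT.
- exact: leq_ltn_trans td.
- exact: leq_ltn_trans td.
- exact: leq_trans bs st.
Qed.

Lemma image_indep s t (a : I -> K) : (0 < s)%N -> (s <= t)%N -> (t <= N)%N ->
  \sum_(i in bars_over s t) a i *: f i t (iunit (bar i) t) = 0 ->
  forall i, i \in bars_over s t -> a i = 0.
Proof.
move=> s0 st tN sum0 i Ai; have t0 := leq_trans s0 st.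
have [_ /(_ t t0 tN 0)[x [_ uniq]]] := dec_f.
pose y j : interval_sp (bar j) t :=
  (if j \in bars_over s t then a j else 0) *: iunit (bar j) t.
have alive j : j \in bars_over s t -> ((bar j).1 <= t < (bar j).2)%N.
  by rewrite inE => /andP[/leq_trans/(_ st)-> ->].
(* the zero vector decomposes both as the sum of the y j and of zeros *)
have y0 : y i = 0.
  rewrite (uniq y) ?(uniq (fun=> 0)) //.
    by rewrite big1 // => j _; rewrite summand_icoord // icoord0 scale0r.
  rewrite -[LHS]sum0 [LHS]big_mkcond /=; apply: eq_bigr => j _.
  rewrite [RHS]summand_icoord // /y icoordZ.
  by case: ifP => [/alive/icoord_unit->|_]; rewrite ?mulr1 ?mul0r ?scale0r.
have <- : icoord (y i) = a i; last by rewrite y0 icoord0.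
by rewrite /y Ai icoordZ icoord_unit ?mulr1 ?alive.
Qed.

Lemma image_generated s t (v : V s) :
  (0 < s)%N -> (s <= t)%N -> (t <= N)%N ->
  exists a : I -> K,
  pm_map t v = \sum_(i in bars_over s t) a i *: f i t (iunit (bar i) t).
Proof.
move=> s0 st tN; have sN := leq_trans st tN.
have [_ /(_ s s0 sN v)[x [-> _]]] := dec_f.
exists (fun i => icoord (x i)).
under eq_bigr => i _ do rewrite summand_icoord //.
rewrite (linear_lincomb (pm_map_linear (p := V) s0 st tN)) [RHS]big_mkcond /=.
apply: eq_bigr => i _; rewrite summand_unit_map //.
by case: ifP => _; rewrite ?scale1r // scale0r scaler0.
Qed.

Lemma in_image s t i : (0 < s)%N -> (s <= t)%N -> (t <= N)%N ->
  i \in bars_over s t ->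
  exists v : V s, f i t (iunit (bar i) t) = pm_map t v.
Proof.
move=> s0 st tN Ai; exists (f i s (iunit (bar i) s)).
by rewrite summand_unit_map // Ai scale1r.
Qed.

End Decomposition.

Section Uniqueness.

Context {K : fieldType} {N : nat} (V : pmodule K N).

Lemma leq_bars_over (I I' : finType) (bar : I -> nat * nat)
    (bar' : I' -> nat * nat)
    (f : forall i t, interval_mod K N (bar i) t -> V t)
    (f' : forall i t, interval_mod K N (bar' i) t -> V t) s t :
  is_direct_sum f -> is_direct_sum f' ->
  (0 < s)%N -> (s <= t)%N -> (t <= N)%N ->
  (#|bars_over bar s t| <= #|bars_over bar' s t|)%N.
Proof.
move=> dec_f dec_f' s0 st tN.
apply: (@leq_card_indep_gen _ _ _ _ _ _ (fun i => f i t (iunit (bar i) t))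
                            (fun i => f' i t (iunit (bar' i) t))).
  by move=> a; apply: (image_indep dec_f).
by move=> i /(in_image dec_f s0 st tN)[v ->]; apply: image_generated.
Qed.

Definition contains_both s t (bd : nat * nat) :=
  ((bd.1 <= s) && (t < bd.2))%N.

(** Inclusion-exclusion, with the negative terms moved to the left: a bar starts
    at b and ends at d exactly if it contains b and d - 1 but neither b - 1 nor
    d. *)
Lemma count_barE (r : seq (nat * nat)) b d : (0 < b)%N -> (0 < d)%N ->
  (count_mem (b, d) r + count (contains_both b.-1 d.-1) r
     + count (contains_both b d) r =
   count (contains_both b d.-1) r + count (contains_both b.-1 d) r)%N.
Proof.
move=> b0 d0; elim: r => // -[b' d'] r /=.
rewrite /contains_both /= xpair_eqE; lia.
Qed.

Lemma interval_decomposition_unique (I I' : finType) (bar : I -> nat * nat)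
    (bar' : I' -> nat * nat)
    (f : forall i t, interval_mod K N (bar i) t -> V t)
    (f' : forall i t, interval_mod K N (bar' i) t -> V t) :
  interval_decomposition f -> interval_decomposition f' ->
  perm_eq [seq bar i | i : I] [seq bar' i | i : I'].
Proof.
move=> [barP dec_f] [barP' dec_f'].
set r := image _ _; set r' := image _ _.
have rP bd : bd \in r -> (0 < bd.1 < bd.2)%N && (bd.2 <= N.+1)%N.
  by case/imageP=> i _ ->.
have rP' bd : bd \in r' -> (0 < bd.1 < bd.2)%N && (bd.2 <= N.+1)%N.
  by case/imageP=> i _ ->.
(* s = 0 and t > N occur in the inclusion-exclusion formula; no bar extends
   that far *)
have bothE s t : (s <= t)%N ->
    count (contains_both s t) r = count (contains_both s t) r'.
  move=> st; have [s0|s0] := posnP s.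
    rewrite !(@eq_in_count _ _ pred0) ?count_pred0 // => bd.
      by move/rP'; rewrite /contains_both /=; lia.
    by move/rP; rewrite /contains_both /=; lia.
  have [tN|tN] := leqP t N; last first.
    rewrite !(@eq_in_count _ _ pred0) ?count_pred0 // => bd.
      by move/rP'; rewrite /contains_both /=; lia.
    by move/rP; rewrite /contains_both /=; lia.
  have countE (L : finType) (c : L -> nat * nat) :
      count (contains_both s t) [seq c i | i : L] = #|bars_over c s t|.
    rewrite count_map -sum1_count -sum1_card big_enum_cond /=.
    by apply: eq_bigl => i; rewrite !inE.
  apply/eqP; rewrite !countE eqn_leq.
  by rewrite (leq_bars_over dec_f dec_f') ?(leq_bars_over dec_f' dec_f).
rewrite /perm_eq; apply/allP=> -[b d] /=; rewrite mem_cat => bd.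
have {bd} /andP[/andP[/= b0 bd] dN] : (0 < b < d)%N && (d <= N.+1)%N.
  by case/orP: bd => [/rP|/rP'].
have d0 := ltn_trans b0 bd.
have := count_barE r b0 d0; have := count_barE r' b0 d0.
rewrite !bothE ?(ltnW bd) //; [|lia..].
by move=> /[swap] <- /eqP; rewrite !eqn_add2r eq_sym.
Qed.

End Uniqueness.

(** * Subspaces adapted to a basis *)

Section Adapted.

Context {K : fieldType} {V : vectType K} {n : nat} (u : 'I_n -> V).
Local Notation ut := [tuple u j | j < n].

Definition adapted (U : {vspace V}) : Prop :=
  forall c j, c \in U -> coord ut j c != 0 -> u j \in U.

Hypothesis basis_u : basis_of fullv ut.

Lemma coord_expand c : c = \sum_j coord ut j c *: u j.
Proof.
rewrite {1}(coord_basis basis_u (memvf c)).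
by apply: eq_bigr => j _; rewrite nth_mktuple.
Qed.

Lemma coord_lincomb (a : 'I_n -> K) j : coord ut j (\sum_i a i *: u i) = a j.
Proof.
rewrite -(coord_sum_free a j (basis_free basis_u)); congr (coord _ _ _).
by apply: eq_bigr => i _; rewrite nth_mktuple.
Qed.

Lemma adapted_basis U : adapted U ->
  basis_of U [seq u j | j in [set j | u j \in U]].
Proof.
move=> adU; have -> : [seq u j | j in [set j | u j \in U]] =
    [seq x <- ut | x \in U].
  rewrite filter_map; congr map; rewrite /enum_mem -filter_predI.
  by apply: eq_filter => j; rewrite /= !inE andbT.
rewrite /basis_of filter_free ?(basis_free basis_u) // andbT eqEsubv.
apply/andP; split.
  by apply/span_subvP => x; rewrite mem_filter => /andP[].
apply/subvP => c Uc; rewrite [c]coord_expand; apply: rpred_sum => j _.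
have [->|nz] := eqVneq (coord ut j c) 0; first by rewrite scale0r mem0v.
apply/memvZ/memv_span; rewrite mem_filter (adU c) //.
by apply/tnthP; exists j; rewrite tnth_mktuple.
Qed.

Lemma adapted_cap U W : adapted U -> adapted W -> adapted (U :&: W)%VS.
Proof.
move=> adU adW c j /memv_capP[Uc Wc] nz.
by rewrite memv_cap (adU c) ?(adW c).
Qed.

Lemma adapted_add U W : adapted U -> adapted W -> adapted (U + W)%VS.
Proof.
move=> adU adW c j /memv_addP[a Ua [b Wb ->]]; rewrite linearD /=.
have [->|nz _] := eqVneq (coord ut j a) 0; last first.
  by apply: subvP (addvSl U W) _ _; apply: adU nz.
by rewrite add0r => nz; apply: subvP (addvSr U W) _ _; apply: adW nz.
Qed.

Context (M : 'M[K]_n) (d : 'End(V)).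
Hypothesis matchM : matching_matrix M.
Hypothesis dE : forall j, d (u j) = \sum_i M i j *: u i.

Lemma coord_endo c i : coord ut i (d c) = \sum_j M i j * coord ut j c.
Proof.
rewrite {1}[c]coord_expand linear_sum linear_sum; apply: eq_bigr => j _.
by rewrite !linearZ /= dE coord_lincomb mulrC.
Qed.

(** At most one basis vector contributes to each coordinate of a boundary. *)
Lemma matching_row_sum i j (a : 'I_n -> K) : M i j != 0 ->
  \sum_k M i k * a k = M i j * a j.
Proof.
move=> Mij; rewrite (bigD1 j) //= big1 ?addr0 // => k /eqP kj.
have [->|Mik] := eqVneq (M i k) 0; first by rewrite mul0r.
by case: kj; apply: matchM.1 Mik Mij.
Qed.

Lemma matched_image i j : M i j != 0 -> d (u j) = M i j *: u i.
Proof.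
move=> Mij; rewrite dE (bigD1 i) //= big1 ?addr0 // => k /eqP ki.
have [->|Mkj] := eqVneq (M k j) 0; first by rewrite scale0r.
by case: ki; apply: matchM.2 Mkj Mij.
Qed.

(** If u_j occurs in c and d u_j involves u_i, then d c involves u_i, as
    nothing can cancel it; so u_i lies in W. *)
Lemma adapted_preim W : adapted W -> adapted (d @^-1: W)%VS.
Proof.
move=> adW c j; rewrite -!memv_preim => Wdc nz.
rewrite dE; apply: rpred_sum => i _.
have [->|Mij] := eqVneq (M i j) 0; first by rewrite scale0r mem0v.
apply/memvZ/(adW _ _ Wdc).
by rewrite coord_endo (matching_row_sum _ Mij) mulf_neq0.
Qed.

(** If d c involves u_i, then c involves the only u_j mapped to a multiple of
    u_i; so u_j lies in U and u_i in its image. *)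
Lemma adapted_img U : adapted U -> adapted (d @: U)%VS.
Proof.
move=> adU _ i /memv_imgP[c Uc ->]; rewrite coord_endo => nz.
have /existsP[j Mij] : [exists j, M i j != 0].
  apply: contraNT nz; rewrite negb_exists => /forallP M0.
  rewrite big1 // => j _; have /negPn/eqP-> := M0 j; exact: mul0r.
have cj : coord ut j c != 0.
  apply: contraNneq nz => cj.
  by rewrite (matching_row_sum _ Mij) cj mulr0.
have -> : u i = (M i j)^-1 *: d (u j).
  by rewrite (matched_image Mij) scalerA mulVf // scale1r.
by apply/memvZ/memv_img/(adU c).
Qed.

End Adapted.

(** * Unitriangular bases of the chain space *)

Section Triangular.

Context {K : fieldType} {X : cellComplex K}.

Lemma mem_cell_span (A : {set X}) (c : chain K X) :
  (c \in cell_span A) <-> (forall s, s \notin A -> c s = 0).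
Proof.
split=> [Ac s nAs|supp].
  rewrite (coord_span (X := in_tuple [seq cell_chain K s | s in A]) Ac).
  rewrite sum_ffunE big1 // => i _.
  have /imageP[r Ar ->] : (in_tuple [seq cell_chain K s | s in A])`_i
      \in [seq cell_chain K s | s in A] by apply: mem_nth.
  by rewrite !ffunE (negPf (memPnC nAs _ Ar)) scaler0.
have -> : c = \sum_s c s *: cell_chain K s.
  apply/ffunP=> r; rewrite sum_ffunE (bigD1 r) //= big1 => [|s sr].
    by rewrite !ffunE eqxx addr0 /= [_ *: _]mulr1.
  by rewrite !ffunE eq_sym (negPf sr) [_ *: _]mulr0.
apply: rpred_sum => s _; have [As|nAs] := boolP (s \in A).
  by apply/memvZ/memv_span/image_f.
by rewrite supp // scale0r mem0v.
Qed.

Context {m : nat} (sigma : 'I_m -> X) (J : 'M[K]_m).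
Hypotheses (sigma_bij : bijective sigma) (triJ : unitriangular J).
Local Notation u := (col_chain sigma J).

Lemma col_chainE i j : u j (sigma i) = J i j.
Proof.
rewrite /col_chain sum_ffunE (bigD1 i) //= big1 => [|k ki].
  by rewrite !ffunE eqxx addr0 /= [_ *: _]mulr1.
by rewrite !ffunE (inj_eq (bij_inj sigma_bij)) eq_sym (negPf ki) [_ *: _]mulr0.
Qed.

Definition initial (A : {set X}) : Prop :=
  forall i j : 'I_m, (i <= j)%N -> sigma j \in A -> sigma i \in A.

(** Consider the last column that occurs in the chain although its cell is
    outside A.  The later columns that occur have their cell in A, which is
    impossible for an initial segment, and the earlier ones vanish at that
    cell; so the coefficient of the chain at that cell is nonzero. *)
Lemma triangular_support (A : {set X}) (a : 'I_m -> K) : initial A ->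
  \sum_j a j *: u j \in cell_span A ->
  forall j, a j != 0 -> sigma j \in A.
Proof.
move=> initA /mem_cell_span supp j0 a0; apply/negPn/negP => nA0.
pose P j := (a j != 0) && (sigma j \notin A).
have P0 : P j0 by rewrite /P a0.
have [j /andP[aj nAj] maxj] := arg_maxnP (fun j : 'I_m => val j) P0.
case/eqP: aj; have := supp _ nAj; rewrite sum_ffunE (bigD1 j) //= big1.
  by rewrite ffunE col_chainE triJ.1 addr0 [_ *: _]mulr1.
move=> k kj; rewrite ffunE col_chainE; have [lt_kj|le_jk] := ltnP k j.
  by rewrite triJ.2 // scaler0.
have [->|ak] := eqVneq (a k) 0; first by rewrite scale0r.
have nAk : sigma k \notin A by apply: contra nAj; apply: initA.
have /maxj /= le_kj : P k by rewrite /P ak.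
by case/eqP: kj; apply/val_inj/anti_leq; rewrite /= le_kj.
Qed.

(** Linear independence is the case of the empty segment. *)
Lemma triangular_basis : basis_of fullv [tuple u j | j < m].
Proof.
have free_u : free [tuple u j | j < m].
  apply/freeP => a sum0 j; apply/eqP/negPn/negP => aj.
  suff: sigma j \in (set0 : {set X}) by rewrite inE.
  apply: triangular_support aj; first by move=> i k _; rewrite !inE.
  under eq_bigr do rewrite -(nth_mktuple (fun j => u j) 0).
  by rewrite sum0 mem0v.
rewrite basisEfree free_u subvf size_tuple /=.
have -> : fullv = cell_span [set: X].
  apply/vspaceP => c; rewrite memvf; apply/esym/mem_cell_span => s.
  by rewrite inE.
rewrite (leq_trans (dim_span _)) // size_image cardsT.
by rewrite -(bij_eq_card sigma_bij) card_ord.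
Qed.

Lemma adapted_cell_span A : initial A -> adapted u (cell_span A).
Proof.
move=> initA c j Ac cj.
have Aj : sigma j \in A.
  apply: (@triangular_support A (fun k => coord [tuple u i | i < m] k c)) => //.
  by rewrite -(coord_expand triangular_basis).
have [tau _ sigmaK] := sigma_bij.
apply/mem_cell_span => s; rewrite -[s]sigmaK => nAi; rewrite col_chainE.
by apply: triJ.2; rewrite ltnNge; apply: contra nAi => /initA; apply.
Qed.

Lemma boundary_col_chain (M : 'M[K]_m) j :
  J *m M = boundary_matrix sigma *m J ->
  boundary X (u j) = \sum_i M i j *: u i.
Proof.
move=> JM; have [tau _ sigmaK] := sigma_bij.
apply/ffunP => s; rewrite -[s]sigmaK; move: (tau s) => i.
have /matrixP/(_ i j) := JM; rewrite !mxE => JMij.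
rewrite /col_chain linear_sum !sum_ffunE.
transitivity (\sum_k boundary_matrix sigma i k * J k j).
  by apply: eq_bigr => k _; rewrite linearZ ffunE mxE mulrC.
rewrite -JMij; apply: eq_bigr => k _.
by rewrite ffunE col_chainE mulrC.
Qed.

End Triangular.

(** * Decomposition of relative persistent homology *)

Lemma min_index_leq N (P : pred nat) t :
  (forall s t, (0 < s)%N -> (s <= t)%N -> (t <= N)%N -> P s -> P t) ->
  (0 < t)%N -> (t <= N)%N -> (min_index N P <= t)%N = P t.
Proof.
move=> monoP t0 tN.
have hasE r : (\big[minn/N.+1]_(i <- r | P i) i <= t)%N =
    has (fun i => P i && (i <= t)%N) r.
  elim: r => [|i r IHr]; first by rewrite big_nil /= leqNgt ltnS tN.
  by rewrite big_cons /=; case: (P i); rewrite ?geq_min IHr.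
rewrite /min_index hasE; apply/hasP/idP => [[s]|Pt].
  rewrite mem_index_iota => /andP[s0 _] /andP[Ps st].
  exact: monoP s0 st tN Ps.
by exists t; rewrite ?mem_index_iota ?t0 ?ltnS ?tN ?Pt //=.
Qed.

Lemma min_index_bounds N (P : pred nat) : (0 < min_index N P <= N.+1)%N.
Proof.
rewrite /min_index big_nat_cond.
elim/big_ind: _ => [|i j|i /andP[]]; rewrite ?leqnn //; lia.
Qed.

Lemma boundary_cell_span (K : fieldType) (X : cellComplex K) (A : {set X})
    (c : chain K X) :
  subcomplex A -> c \in cell_span A -> boundary X c \in cell_span A.
Proof.
move=> subA Ac; suff : (cell_span A <= boundary X @^-1: cell_span A)%VS.
  by move/subvP/(_ c Ac); rewrite -memv_preim.
apply/span_subvP => _ /imageP[s As ->]; rewrite -memv_preim; exact: subA.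
Qed.

Section RelativePersistence.

Context {K : fieldType} {X : cellComplex K} {N : nat} (F G : filtration X N).
Local Notation Z t := (rel_cycles (F t) (G t)).
Local Notation B t := (rel_boundaries (F t) (G t)).
Local Notation cls t := (hom_class F G t).

Hypothesis sub_GF : forall t, (0 < t)%N -> (t <= N)%N -> G t \subset F t.

Lemma rel_boundaries_cycles t : (0 < t)%N -> (t <= N)%N -> (B t <= Z t)%VS.
Proof.
move=> t0 tN; have subF := @fil_subcomplex _ _ _ F t t0 tN.
have subG := @fil_subcomplex _ _ _ G t t0 tN.
have sGF := subvP (cell_spanS (sub_GF t0 tN)).
apply/subvP => _ /memv_addP[_ /memv_imgP[c Fc ->] [g Gg ->]].
rewrite memv_cap -memv_preim linearD /=.
have -> : boundary X (boundary X c) = 0.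
  by rewrite -comp_lfunE boundaryK lfunE.
rewrite add0r (boundary_cell_span subG Gg) andbT.
by rewrite rpredD ?(boundary_cell_span subF Fc) ?sGF.
Qed.

Lemma hom_class_eq0 t c : c \in Z t -> cls t c = 0 <-> c \in B t.
Proof.
move=> Zc; rewrite -(linear_zero (hom_class_linear F G t)) /hom_class.
by rewrite quot_class_eq mem_Bsp linearB /= !vsprojK ?mem0v // subr0.
Qed.

Lemma f_ker_leq c t : (0 < t)%N -> (t <= N)%N ->
  (f_ker F G c <= t)%N = (c \in Z t).
Proof.
apply: min_index_leq => r s r0 rs sN; exact: subvP (rel_cyclesS F G r0 rs sN) c.
Qed.

Lemma f_im_leq c t : (0 < t)%N -> (t <= N)%N ->
  (f_im F G c <= t)%N = (c \in B t).
Proof.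
apply: min_index_leq => r s r0 rs sN.
exact: subvP (rel_boundariesS F G r0 rs sN) c.
Qed.

Lemma f_ker_f_im c : (f_ker F G c <= f_im F G c)%N.
Proof.
have /andP[_ ker_le] := min_index_bounds N (fun t => c \in Z t).
have /andP[im_gt0 _] := min_index_bounds N (fun t => c \in B t).
have [imN|] := leqP (f_im F G c) N; last exact: leq_trans.
rewrite f_ker_leq //; apply: (subvP (rel_boundaries_cycles im_gt0 imN)).
by rewrite -f_im_leq.
Qed.

Lemma alive_class c t : (0 < t)%N -> (t <= N)%N ->
  (f_ker F G c <= t < f_im F G c)%N = (c \in Z t) && (c \notin B t).
Proof. by move=> t0 tN; rewrite ltnNge f_ker_leq ?f_im_leq. Qed.

Context {m : nat} (u : 'I_m -> chain K X).
Hypothesis basis_u : basis_of fullv [tuple u j | j < m].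
Hypothesis adZ : forall t, (0 < t)%N -> (t <= N)%N -> adapted u (Z t).
Hypothesis adB : forall t, (0 < t)%N -> (t <= N)%N -> adapted u (B t).

Local Notation nonempty :=
  (fun j : 'I_m => f_ker F G (u j) != f_im F G (u j)).
Local Notation bar := (fun j : {j : 'I_m | nonempty j} =>
  (f_ker F G (u (val j)), f_im F G (u (val j)))).

Definition bar_map (j : {j : 'I_m | nonempty j}) t
    (x : interval_mod K N (bar j) t) : rel_homology F G t :=
  icoord x *: cls t (u (val j)).

Lemma bar_map_morphism j : is_pmorphism (@bar_map j).
Proof.
split=> [t _ _ a x y|s t s0 st tN x].
  by rewrite /bar_map icoord_linear scalerDl scalerA.
have [t0 sN] := (leq_trans s0 st, leq_trans st tN).
rewrite /bar_map /=.
rewrite [RHS](linear_scale (hom_map_linear (F := F) (G := G) s0 st tN)).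
have [alive_s|dead_s] := boolP ((bar j).1 <= s < (bar j).2)%N; last first.
  rewrite (interval_sp_eq0 x dead_s) /interval_map mul0mx.
  by rewrite !icoord0 !scale0r.
have /andP[Zu _] : (u (val j) \in Z s) && (u (val j) \notin B s).
  by rewrite -alive_class.
rewrite hom_map_class //.
have [alive_t|dead_t] := boolP ((bar j).1 <= t < (bar j).2)%N.
  by rewrite icoord_map.
have Zt : u (val j) \in Z t by apply: subvP (rel_cyclesS F G s0 st tN) _ Zu.
move: dead_t; rewrite alive_class // Zt /= negbK => /(hom_class_eq0 Zt)->.
by rewrite !scaler0.
Qed.

(** At index t, the columns outside Z(F_t, G_t) do not occur in a relative
    cycle, and those in B(F_t, G_t) have class zero, so the classes of the
    remaining columns generate the homology.  They are independent because a
    relation between them is a relative boundary, which only involves columns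
    in B(F_t, G_t). *)
Lemma bar_map_direct_sum : is_direct_sum bar_map.
Proof.
split=> [|t t0 tN v]; first exact: bar_map_morphism.
have lin_cls := hom_class_linear F G t.
have alive (j : {j | nonempty j}) : ((bar j).1 <= t < (bar j).2)%N =
  (u (val j) \in Z t) && (u (val j) \notin B t) by rewrite alive_class.
have [c Zc ->] := hom_class_surj v.
pose cd j := coord [tuple u i | i < m] j c.
exists (fun j => cd (val j) *: iunit (bar j) t : interval_sp (bar j) t).
have classE : cls t c = \sum_j bar_map
    (cd (val j) *: iunit (bar j) t : interval_sp (bar j) t).
  rewrite {1}(coord_expand basis_u c) (linear_lincomb lin_cls).
  (* a column with an empty bar that occurs in c is a relative boundary *)
  rewrite (bigID nonempty) /= [X in _ + X]big1 ?addr0 => [|j]; last first.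
    rewrite negbK => /eqP empty.
    have [->|/(adZ t0 tN Zc) Zu] := eqVneq (coord [tuple u i | i < m] j c) 0.
      by rewrite scale0r.
    rewrite (hom_class_eq0 Zu).2 ?scaler0 //.
    by rewrite -f_im_leq // -empty f_ker_leq.
  rewrite (reindex_omap (val : {j | nonempty j} -> _) insub) /=; last first.
    by move=> j nej; rewrite insubT.
  apply: eq_big => [j|j _]; first by rewrite valK eqxx andbT (valP j).
  rewrite /bar_map icoordZ -/(cd (val j)).
  have [|dead] := boolP ((bar j).1 <= t < (bar j).2)%N.
    by move/icoord_unit->; rewrite mulr1.
  have [->|/(adZ t0 tN Zc) Zu] := eqVneq (cd (val j)) 0.
    by rewrite mul0r !scale0r.
  move: dead; rewrite alive Zu /= negbK => /(hom_class_eq0 Zu)->.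
  by rewrite !scaler0.
split=> // y; rewrite classE => sumE.
set x := fun j : {j | nonempty j} =>
  (cd (val j) *: iunit (bar j) t : interval_sp (bar j) t) in sumE *.
(* z represents the difference of the two decompositions, hence bounds *)
pose a j := icoord (y j) - icoord (x j).
pose z := \sum_j a j *: u (val j).
have a_dead j : ~~ ((bar j).1 <= t < (bar j).2)%N -> a j = 0.
  move=> dead; rewrite /a.
  by rewrite (interval_sp_eq0 (y j) dead) (interval_sp_eq0 (x j) dead) subrr.
have Zz : z \in Z t.
  apply: rpred_sum => j _.
  have [|/a_dead->] := boolP ((bar j).1 <= t < (bar j).2)%N; last first.
    by rewrite scale0r mem0v.
  by rewrite alive => /andP[Zu _]; apply: memvZ.
have Bz : z \in B t.
  apply/(hom_class_eq0 Zz); rewrite (linear_lincomb lin_cls).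
  under eq_bigr => j _ do rewrite scalerBl.
  by rewrite sumrB; apply/eqP; rewrite subr_eq0 -[X in X == _]sumE.
move=> j; change (y j = x j).
have [alive_j|dead] := boolP ((bar j).1 <= t < (bar j).2)%N; last first.
  by rewrite (interval_sp_eq0 (y j) dead) (interval_sp_eq0 (x j) dead).
suff aj : a j = 0.
  rewrite [LHS]icoordE [RHS]icoordE; congr (_ *: _).
  by apply/eqP; rewrite -subr_eq0 -/(a j) aj.
apply/eqP/negPn/negP => aj.
move: alive_j; rewrite alive => /andP[_ /negP]; apply.
apply: (adB t0 tN Bz).
have free_u := basis_free basis_u.
have coord_u k : coord [tuple u i | i < m] (val j) (u k) = (val j == k)%:R.
  by rewrite eq_sym -(coord_free k (val j) free_u) nth_mktuple.
rewrite linear_sum (bigD1 j) //= big1 ?addr0 => [|k kj].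
  by rewrite linearZ /= coord_u eqxx mulr1.
by rewrite linearZ /= coord_u (inj_eq val_inj) eq_sym (negPf kj) mulr0.
Qed.

Lemma bar_map_decomposition : interval_decomposition bar_map.
Proof.
split=> [j /=|]; last exact: bar_map_direct_sum.
have /andP[ker_gt0 _] := min_index_bounds N (fun t => u (val j) \in Z t).
have /andP[_ im_le] := min_index_bounds N (fun t => u (val j) \in B t).
apply/andP; split=> //; apply/andP; split=> //.
by rewrite ltn_neqAle f_ker_f_im (valP j).
Qed.

Lemma bar_map_representative j : cycle_representative bar_map j (u (val j)).
Proof.
move=> t alive; have /andP[/= ker_t t_im] := alive.
have /andP[ker_gt0 _] := min_index_bounds N (fun t => u (val j) \in Z t).
have /andP[_ im_le] := min_index_bounds N (fun t => u (val j) \in B t).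
have t0 : (0 < t)%N by apply: leq_trans ker_t.
have tN : (t <= N)%N by rewrite -ltnS; apply: leq_trans im_le.
split=> [|h]; first by rewrite -f_ker_leq.
split=> [[x ->]|[a ->]]; first by exists (icoord (bd := bar j) (t := t) x).
exists (a *: iunit (bar j) t : interval_sp (bar j) t).
by rewrite /bar_map icoordZ icoord_unit ?mulr1.
Qed.

End RelativePersistence.

(** * Columns of a U-match as relative cycle representatives *)

Theorem mainTheorem3 (K : fieldType) (X : cellComplex K) (N : nat)
    (F G : filtration X N) (l : nat) (lagFG : is_lag F G l)
    (m : nat) (sigma : 'I_m -> X) (sigma_bij : bijective sigma)
    (sigma_ordered : forall i j : 'I_m, (i <= j)%N ->
       (birth F (sigma i) <= birth F (sigma j))%N)
    (J M : 'M[K]_m) (JM : U_match J M (boundary_matrix sigma) J) :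
  let u := col_chain sigma J in
  let nonempty := fun j : 'I_m => f_ker F G (u j) != f_im F G (u j) in
  let bar := fun j : {j : 'I_m | nonempty j} =>
    (f_ker F G (u (val j)), f_im F G (u (val j))) in
  (forall t : nat, (0 < t)%N -> (t <= N)%N ->
     columns_contain_basis sigma J (rel_cycles (F t) (G t)) /\
     columns_contain_basis sigma J (rel_boundaries (F t) (G t))) /\
  (exists f : forall j t, interval_mod K N (bar j) t -> rel_homology F G t,
     interval_decomposition f /\
     forall j, cycle_representative f j (u (val j))) /\
  (forall s : seq (nat * nat),
     is_barcode (rel_homology F G) s <->
     perm_eq s [seq bar j | j : {j : 'I_m | nonempty j}]).
Proof.
move=> u nonempty bar; have [JMD triJ _ matchM] := JM.
have initF t : (0 < t)%N -> (t <= N)%N -> initial sigma (F t).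
  move=> t0 tN i j ij.
  have birthE s : (s \in F t) = (birth F s <= t)%N.
    rewrite [RHS]min_index_leq // => p q p0 pq qN.
    exact: subsetP (fil_mono F p0 pq qN) s.
  by rewrite !birthE; apply/leq_trans/sigma_ordered.
have initG t : (0 < t)%N -> (t <= N)%N -> initial sigma (G t).
  move=> t0 tN; rewrite lagFG //; case: ifP => [lt|_ i j _].
    by apply: initF; lia.
  by rewrite !inE.
have sub_GF t : (0 < t)%N -> (t <= N)%N -> G t \subset F t.
  move=> t0 tN; rewrite lagFG //; case: ifP => [lt|_]; last exact: sub0set.
  by apply: fil_mono => //; lia.
have basis_u := triangular_basis sigma_bij triJ.
have dE j := boundary_col_chain sigma_bij j JMD.
have adZ t : (0 < t)%N -> (t <= N)%N -> adapted u (rel_cycles (F t) (G t)).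
  move=> t0 tN; apply: adapted_cap.
    by apply: adapted_cell_span => //; apply: initF.
  apply: (adapted_preim basis_u matchM dE).
  by apply: adapted_cell_span => //; apply: initG.
have adB t : (0 < t)%N -> (t <= N)%N -> adapted u (rel_boundaries (F t) (G t)).
  move=> t0 tN; apply: adapted_add.
    apply: (adapted_img basis_u matchM dE).
    by apply: adapted_cell_span => //; apply: initF.
  by apply: adapted_cell_span => //; apply: initG.
have dec := bar_map_decomposition sub_GF basis_u adZ adB.
split=> [t t0 tN|].
  split; [exists [set j | u j \in rel_cycles (F t) (G t)]
         | exists [set j | u j \in rel_boundaries (F t) (G t)]].
    exact: (adapted_basis basis_u (adZ t t0 tN)).
  exact: (adapted_basis basis_u (adB t t0 tN)).
split; first by exists (@bar_map _ _ _ F G _ u); split;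
  [exact: dec | exact: bar_map_representative].
move=> s; split=> [[I [c [f [dec_f perm_s]]]]|perm_s].
  exact: perm_trans perm_s (interval_decomposition_unique dec_f dec).
by exists _, bar, (@bar_map _ _ _ F G _ u); split; [exact: dec | exact: perm_s].
Qed.
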